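(* Suppose that $-1\le\beta<0$. If $S$ is a spherical $\{0,\beta\}$-code of size $n$ and rank $r$, then one of the following holds: (1) $\lambda_1(\Gamma_\beta(S))<\frac{1}{-\beta}$ and $n=r$. (2) $\lambda_1(\Gamma_\beta(S))=\frac{1}{-\beta}$, and this eigenvalue of $\Gamma_\beta(S)$ has codimension $r$. Conversely, if an $n$-vertex graph $G$ satisfies (1) or (2) (with $G$ in place of $\Gamma_\beta(S)$, for an integer $r$), then there exists a spherical $\{0,\beta\}$-code $S$ of rank $r$ such that $\Gamma_\beta(S)=G$.
   Context: A spherical $\{0,\beta\}$-code is a finite nonempty set $S$ of unit vectors in some $\mathbb{R}^m$ such that $x^\top y\in\{0,\beta\}$ for any two distinct $x,y\in S$ (it is allowed that only one of the values occurs). The rank of $S$ is the dimension of the linear span of $S$. For $S=\{u_1,\dots,u_n\}$, the associated $\beta$-graph $\Gamma_\beta(S)$ is the simple graph with vertex set $S$ in which $u_i,u_j$ ($i\ne j$) are adjacent iff $u_i^\top u_j=\beta$. Equality $\Gamma_\beta(S)=G$ is understood up to graph isomorphism. Graphs are finite and simple; $\lambda_1(G)$ is the largest eigenvalue of the adjacency matrix $A_G$ of $G$. For an eigenvalue $\lambda$ of an $n$-vertex graph $G$ with multiplicity $m$, its codimension in $G$ is $n-m=\mathrm{rank}(\lambda I-A_G)$. *)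

(* Defs.v *)
From HB Require Import structures.
From mathcomp Require Import all_boot all_order all_algebra finmap.
From mathcomp Require Import classical_sets reals.

Set Implicit Arguments.
Unset Strict Implicit.
Unset Printing Implicit Defensive.

Import Order.TTheory GRing.Theory Num.Theory.
Local Open Scope ring_scope.

Record sgraph := SGraph {
  svertex :> finType;
  sedge : rel svertex;
  sedge_sym : symmetric sedge;
  sedge_irrefl : irreflexive sedge }.

Definition sgraph_iso (G H : sgraph) : Prop :=
  exists2 f : G -> H, bijective f & forall x y, sedge (f x) (f y) = sedge x y.

Definition adjmx (R : realType) (G : sgraph) : 'M[R]_#|G| :=
  \matrix_(i, j) (sedge (enum_val i) (enum_val j))%:R.

(* A real symmetric matrix of positive size has a finite nonempty set of
   eigenvalues, so for a nonempty graph this supremum is a maximum. For the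
   graph with no vertices it has the junk value 0. *)
Definition lambda1 (R : realType) (G : sgraph) : R :=
  sup [set a : R | eigenvalue (adjmx R G) a]%classic.

(* Geometric multiplicity; it equals the algebraic one as adjmx is symmetric. *)
Definition eig_mult (R : realType) (G : sgraph) (a : R) : nat :=
  \rank (eigenspace (adjmx R G) a).

Definition eig_codim (R : realType) (G : sgraph) (a : R) : nat :=
  (#|G| - eig_mult G a)%N.

Lemma eig_codimE (R : realType) (G : sgraph) (a : R) :
  eig_codim G a = \rank (a%:M - adjmx R G).
Proof.
rewrite /eig_codim /eig_mult /eigenspace mxrank_ker subKn ?rank_leq_row //.
by rewrite -opprB mxrank_opp.
Qed.

Definition dot (R : realType) (m : nat) (x y : 'cV[R]_m) : R :=
  (x^T *m y) 0 0.

Lemma dotC (R : realType) (m : nat) (x y : 'cV[R]_m) : dot x y = dot y x.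
Proof. by rewrite /dot -[x in RHS]trmxK -trmx_mul [RHS]mxE. Qed.

(* Unit vectors are stated with [dot] because the norm that MathComp-Analysis
   puts on matrices is the sup norm. *)
Definition spherical_code (R : realType) (m : nat) (beta : R)
    (S : {fset 'cV[R]_m}) : Prop :=
  [/\ S != fset0%fset,
      forall x, x \in S -> dot x x = 1
    & forall x y, x \in S -> y \in S -> x != y ->
        dot x y = 0 \/ dot x y = beta].

Definition code_rank (R : realType) (m : nat) (S : {fset 'cV[R]_m}) : nat :=
  \dim <<enum_fset S>>%VS.

Section BetaGraph.
Variables (R : realType) (m : nat) (beta : R) (S : {fset 'cV[R]_m}).

Definition beta_edge : rel S :=
  fun x y => (x != y) && (dot (val x) (val y) == beta).

Lemma beta_edge_sym : symmetric beta_edge.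
Proof. by move=> x y; rewrite /beta_edge eq_sym dotC. Qed.

Lemma beta_edge_irrefl : irreflexive beta_edge.
Proof. by move=> x; rewrite /beta_edge eqxx. Qed.

Definition beta_graph : sgraph := SGraph beta_edge_sym beta_edge_irrefl.

End BetaGraph.

(* Main.v *)
(* The Gram matrix of a code with beta-graph G is
   [M = 1 + beta A = -beta (t - A)], where A is the adjacency matrix of G and
   [t = 1 / - beta]. Conversely, [1 + beta A] is the Gram matrix of unit vectors
   spanning a space of dimension r as soon as it is positive semidefinite of
   rank r. Positivity of [t - A] means that lambda1 <= t, and the rank of [t - A]
   is the codimension of t, which is full when lambda1 < t. *)

Require Import Defs.
From HB Require Import structures.
From mathcomp Require Import all_boot all_order all_algebra finmap.
From mathcomp Require Import classical_sets reals.
From mathcomp Require Import ring lra.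

Set Implicit Arguments.
Unset Strict Implicit.
Unset Printing Implicit Defensive.

Import Order.TTheory GRing.Theory Num.Theory.
Local Open Scope ring_scope.

Definition qform (R : realType) (n : nat) (M : 'M[R]_n) (v : 'rV[R]_n) : R :=
  (v *m M *m v^T) 0 0.

(* Symmetry is not part of [psd]; it is assumed separately where needed. *)
Definition psd (R : realType) (n : nat) (M : 'M[R]_n) : Prop :=
  forall v, 0 <= qform M v.

(** * Quadratic forms, Gram matrices and spectral bounds *)

Section QuadraticForms.
Variable R : realType.

Lemma qformD n (M N : 'M[R]_n) v : qform (M + N) v = qform M v + qform N v.
Proof. by rewrite /qform mulmxDr mulmxDl mxE. Qed.

Lemma qformZ n a (M : 'M[R]_n) v : qform (a *: M) v = a * qform M v.
Proof. by rewrite /qform -scalemxAr -scalemxAl mxE. Qed.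

Lemma qformN n (M : 'M[R]_n) v : qform (- M) v = - qform M v.
Proof. by rewrite -scaleN1r qformZ mulN1r. Qed.

Lemma qform_scalar n a (v : 'rV[R]_n) : qform a%:M v = a * qform 1%:M v.
Proof. by rewrite -qformZ scalemx1. Qed.

Lemma qform1E n (v : 'rV[R]_n) : qform 1%:M v = \sum_i v 0 i ^+ 2.
Proof.
by rewrite /qform mulmx1 mxE; apply: eq_bigr => i _; rewrite mxE expr2.
Qed.

Lemma qform_gram n m (Y : 'M[R]_(n, m)) v :
  qform (Y *m Y^T) v = qform 1%:M (v *m Y).
Proof. by rewrite /qform mulmx1 trmx_mul !mulmxA. Qed.

Lemma qform1_ge0 n (v : 'rV[R]_n) : 0 <= qform 1%:M v.
Proof. by rewrite qform1E sumr_ge0 // => i _; rewrite sqr_ge0. Qed.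

Lemma qform1_eq0 n (v : 'rV[R]_n) : (qform 1%:M v == 0) = (v == 0).
Proof.
apply/idP/eqP => [|->]; last by rewrite /qform !mul0mx mxE.
rewrite qform1E psumr_eq0 => [/allP v0|i _]; last exact: sqr_ge0.
apply/rowP => i; rewrite mxE; apply/eqP; rewrite -sqrf_eq0.
by apply: v0; rewrite mem_index_enum.
Qed.

Lemma qform1_gt0 n (v : 'rV[R]_n) : v != 0 -> 0 < qform 1%:M v.
Proof. by move=> v0; rewrite lt0r qform1_eq0 v0 qform1_ge0. Qed.

Lemma psd_gram n m (Y : 'M[R]_(n, m)) : psd (Y *m Y^T).
Proof. by move=> v; rewrite qform_gram qform1_ge0. Qed.

(** If [v *m Y *m Y^T = 0] then [v *m Y] has squared length 0, so [Y *m Y^T] and [Y] have the same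
    left kernel. *)
Lemma mxrank_gram n m (Y : 'M[R]_(n, m)) : \rank (Y *m Y^T) = \rank Y.
Proof.
apply/eqP; rewrite eqn_leq mxrankM_maxl /=.
have le_ker : (kermx (Y *m Y^T) <= kermx Y)%MS.
  apply/rV_subP => v /sub_kermxP vYY; apply/sub_kermxP/eqP.
  by rewrite -qform1_eq0 -qform_gram /qform vYY mul0mx mxE.
have := mxrankS le_ker; rewrite !mxrank_ker.
by rewrite leq_sub2lE // rank_leq_row.
Qed.

Lemma qform1_row_mx n1 n2 (u : 'rV[R]_n1) (v : 'rV_n2) :
  qform 1%:M (row_mx u v) = qform 1%:M u + qform 1%:M v.
Proof. by rewrite /qform !mulmx1 tr_row_mx mul_row_col mxE. Qed.

Lemma qform1_add_le n (u v : 'rV[R]_n) :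
  qform 1%:M (u + v) <= 2 * (qform 1%:M u + qform 1%:M v).
Proof.
rewrite !qform1E -big_split mulr_sumr; apply: ler_sum => i _ /=; rewrite mxE.
have := sqr_ge0 (u 0 i - v 0 i); nra.
Qed.

(** A crude operator norm bound, by induction on the rows: splitting off a first row [b] turns [K]
    into [2 * (qform 1%:M b + K)]. *)
Lemma mulmx_bounded n m (B : 'M[R]_(n, m)) :
  exists2 K, 0 < K & forall v, qform 1%:M (v *m B) <= K * qform 1%:M v.
Proof.
elim: n B => [|n IHn] B.
  exists 1 => // v; rewrite (flatmx0 B) mulmx0 mul1r.
  by rewrite /qform !mul0mx mxE qform1_ge0.
rewrite -[B](@vsubmxK _ 1 n m); set b := usubmx _; set C := dsubmx _.
have [K K0 leK] := IHn C.
have b0 := qform1_ge0 b.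
exists (2 * (qform 1%:M b + K)); first by rewrite mulr_gt0 // ltr_wpDl.
move=> v; rewrite -[v](@hsubmxK _ 1 1 n) (@mul_row_col _ 1 1 n m).
set x := lsubmx _; set w := rsubmx _.
rewrite (@qform1_row_mx 1 n); apply: le_trans (qform1_add_le _ _) _.
have -> : qform 1%:M (x *m b) = qform 1%:M x * qform 1%:M b.
  rewrite !qform1E big_ord1 mulr_sumr; apply: eq_bigr => i _.
  by rewrite mxE big_ord1 exprMn.
have := leK w; have := qform1_ge0 w; have := qform1_ge0 x; nra.
Qed.

(** The form of [A] at [v] is the inner product of [v *m A] and [v]; bound it termwise by x y <= x^2
    + y^2. This bounds the eigenvalues from above. *)
Lemma qform_bounded n (A : 'M[R]_n) : exists K, psd (K%:M - A).
Proof.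
have [K K0 leK] := mulmx_bounded A; exists (1 + K) => v.
rewrite qformD qformN qform_scalar.
have : qform A v <= qform 1%:M v + qform 1%:M (v *m A).
  rewrite !qform1E {1}/qform mxE -big_split; apply: ler_sum => i _ /=.
  rewrite [v^T _ _]mxE; move: (v 0 i) ((v *m A) 0 i) => x y.
  have := sqr_ge0 (x - y); have := sqr_ge0 (x + y); nra.
have := leK v; have := qform1_ge0 v; nra.
Qed.

(** At an eigenvector [v] the form equals [(s - a) * qform 1%:M v], whose second factor is
    positive. *)
Lemma psd_eigenvalue_le n (A : 'M[R]_n) s a :
  psd (s%:M - A) -> eigenvalue A a -> a <= s.
Proof.
move=> psdA /eigenvalueP[v vA v0]; have := psdA v.
rewrite qformD qformN qform_scalar {2}/qform vA -[a *: v]mul_mx_scalar.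
rewrite -/(qform a%:M v) (qform_scalar a) -mulrBl.
by rewrite pmulr_lge0 ?qform1_gt0 ?subr_ge0.
Qed.

Lemma eigenvalue_rank n (A : 'M[R]_n) a :
  eigenvalue A a = (\rank (a%:M - A) != n).
Proof.
rewrite /eigenvalue -mxrank_eq0 /eigenspace mxrank_ker subn_eq0.
by rewrite -opprB mxrank_opp eqn_leq rank_leq_row.
Qed.

Lemma qform_block n a (b : 'rV[R]_n) (c : 'cV_n) D (x : 'rV_1) (w : 'rV_n) :
  qform (block_mx a b c D) (row_mx x w) =
  qform a x + (x *m b *m w^T) 0 0 + (w *m c *m x^T) 0 0 + qform D w.
Proof.
rewrite /qform mul_row_block tr_row_mx mul_row_col !mulmxDl !mxE.
by rewrite -!addrA; congr (_ + _); rewrite addrCA.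
Qed.

(* Cholesky decomposition by Schur complements. If the corner entry a vanishes,
   then so does b, and the convention [0^-1 = 0] makes the formulas of the case
   [0 < a] valid there too. *)
Lemma psd_gram_exists n (M : 'M[R]_n) :
  M^T = M -> psd M -> exists Y : 'M[R]_n, Y *m Y^T = M.
Proof.
elim: n M => [|n IHn] M symM psdM.
  by exists 0; apply/matrixP => -[].
pose a := M 0 0; pose b : 'rV_n := @ursubmx _ 1 n 1 n M.
pose D : 'M_n := @drsubmx _ 1 n 1 n M.
have defM : M = block_mx a%:M b b^T D :> 'M_(1 + n).
  rewrite -[M in LHS](@submxK _ 1 n 1 n); congr block_mx; last first.
    by rewrite -[M in LHS]symM trmx_ursub.
  by rewrite [LHS]mx11_scalar !mxE; congr (M _ _)%:M; apply/val_inj.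
have symD : D^T = D by rewrite /D (@trmx_drsub _ 1 n 1 n) symM.
have qM (x : R) (w : 'rV_n) : qform M (row_mx x%:M w : 'rV_(1 + n)) =
    a * x ^+ 2 + (b *m w^T) 0 0 * x *+ 2 + qform D w.
  have wb : (w *m b^T) 0 0 = (b *m w^T) 0 0.
    by rewrite -[w in LHS]trmxK -trmx_mul mxE.
  rewrite {1}defM qform_block {1}/qform tr_scalar_mx -!scalar_mxM mul_scalar_mx.
  rewrite mul_mx_scalar -scalemxAl [(x * a * x)%:M _ _]mxE.
  rewrite [(x *: (_ *m _) : 'M_1) _ _]mxE.
  by rewrite [(x *: (_ *m _) : 'M_1) _ _]mxE wb mulr1n; ring.
have a_ge0 : 0 <= a.
  have := psdM (row_mx 1%:M 0 : 'rV_(1 + n)); rewrite qM.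
  by rewrite trmx0 mulmx0 /qform !mul0mx !mxE mul0r mul0rn !addr0 expr1n mulr1.
have aVb : (a * a^-1) *: b = b.
  have [a0|a_neq0] := eqVneq a 0; last by rewrite divff ?scale1r.
  have [->|b_neq0] := eqVneq b 0; first by rewrite scaler0.
  have := qform1_gt0 b_neq0; rewrite {1}/qform mulmx1.
  set c := (b *m b^T) 0 0 => c_gt0.
  (* With [a = 0] the form is affine in the first coordinate, with slope [2 * c]; this choice gives
     it the value -1. *)
  have := psdM (row_mx (- (qform D b + 1) / (2 * c))%:M b : 'rV_(1 + n)).
  rewrite qM a0 mul0r add0r -/c.
  have -> : c * (- (qform D b + 1) / (2 * c)) *+ 2 = - (qform D b + 1).
    by field; rewrite gt_eqF.
  by rewrite opprD addrAC addNr add0r ler0N1.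
have [||Z defZ] := IHn (D - a^-1 *: (b^T *m b)).
- by rewrite linearB linearZ /= trmx_mul trmxK symD.
(* Completing the square: at this [x] the form of [M] takes the value of the Schur complement at
   [w]. *)
- move=> w; pose x := - (a^-1 * (b *m w^T) 0 0).
  have := psdM (row_mx x%:M w : 'rV_(1 + n)); rewrite /x.
  rewrite qM qformD qformN qformZ.
  have -> : qform (b^T *m b) w = (b *m w^T) 0 0 ^+ 2.
    rewrite /qform mulmxA -mulmxA mxE big_ord1 expr2; congr (_ * _).
    by rewrite -[w in LHS]trmxK -trmx_mul mxE.
  have : a * a^-1 * (b *m w^T) 0 0 = (b *m w^T) 0 0.
    by rewrite -[b in RHS]aVb -scalemxAl [RHS]mxE.
  set c := (b *m w^T) 0 0 => ac.
  have -> : a * (- (a^-1 * c)) ^+ 2 = a^-1 * c ^+ 2.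
    transitivity (a^-1 * (a * a^-1 * c) * c); first by ring.
    by rewrite ac; ring.
  by congr (0 <= _); ring.
pose p := Num.sqrt a.
have pp : p * p = a by rewrite -expr2 sqr_sqrtr.
exists (block_mx p%:M 0 (p^-1 *: b^T) Z : 'M_(1 + n)).
rewrite [in RHS]defM (@tr_block_mx _ 1 n 1 n) (@mulmx_block _ 1 n 1 n 1 n).
have pb : (p * p^-1) *: b = b.
  have [p0|p_neq0] := eqVneq p 0; last by rewrite divff ?scale1r.
  by rewrite p0 mul0r scale0r -[RHS]aVb -pp p0 !mul0r scale0r.
apply: (f_equal4 (@block_mx R 1 n 1 n)).
- by rewrite mul0mx addr0 tr_scalar_mx -scalar_mxM pp.
- by rewrite mul0mx addr0 linearZ /= trmxK mul_scalar_mx scalerA pb.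
- rewrite trmx0 mulmx0 addr0 tr_scalar_mx mul_mx_scalar scalerA.
  by rewrite -[in RHS]pb linearZ.
- rewrite linearZ /= trmxK -scalemxAl -scalemxAr scalerA -invfM pp defZ.
  by rewrite addrC subrK.
Qed.

(* The infimum s of the shifts making [s%:M - A] positive semidefinite is itself
   an eigenvalue: otherwise [s%:M - A = Y *m Y^T] with [Y] invertible, hence
   coercive, and s could be decreased. *)
Lemma psd_eigenvalue_bound n (A : 'M[R]_n) t :
  A^T = A -> (forall a, eigenvalue A a -> a <= t) -> psd (t%:M - A).
Proof.
(* Dimension 0 is separate: bounding [E] from below takes a nonzero vector. *)
case: n A => [|n] A symA le_t.
  by move=> v; rewrite (thinmx0 v) /qform !mul0mx mxE.
pose E := [set s : R | psd (s%:M - A)]%classic.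
have E_ge s v : E s -> qform A v <= s * qform 1%:M v.
  by move=> /(_ v); rewrite qformD qformN qform_scalar subr_ge0.
have E_lb v : v != 0 -> lbound E (qform A v / qform 1%:M v).
  move=> /qform1_gt0 v0 s /E_ge le_s.
  by rewrite ler_pdivrMr.
have E_n0 : (E !=set0)%classic by have [K EK] := qform_bounded A; exists K.
(* The infimum is attained: every Rayleigh quotient is a lower bound of [E], hence at most
   [inf E]. *)
have E_inf : E (inf E).
  move=> v; rewrite qformD qformN qform_scalar subr_ge0.
  have [->|v0] := eqVneq v 0; first by rewrite /qform !mul0mx mxE mulr0.
  by rewrite -ler_pdivrMr ?qform1_gt0 // lb_le_inf //; apply: E_lb.
have E_le_t : inf E <= t.
  apply: le_t; rewrite eigenvalue_rank; apply/negP => /eqP rk.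
  have [Y defY] : exists Y : 'M_n.+1, Y *m Y^T = (inf E)%:M - A.
    apply: psd_gram_exists E_inf.
    by rewrite linearB /= tr_scalar_mx symA.
  have unitY : Y \in unitmx.
    by rewrite -row_free_unit /row_free -mxrank_gram defY rk.
  have [K K0 leK] := mulmx_bounded (invmx Y).
  (* Since [v] is [v *m Y] times the inverse of [Y], its squared length is at most [K] times that of
     [v *m Y], which leaves room to lower the shift by [K^-1]. *)
  have : E (inf E - K^-1).
    move=> v; rewrite raddfB /= addrAC qformD qformN (qform_scalar K^-1).
    rewrite -defY qform_gram subr_ge0 mulrC ler_pdivrMr // mulrC.
    by have := leK (v *m Y); rewrite mulmxK.
  pose v1 : 'rV[R]_n.+1 := const_mx 1.
  have E_hlb : has_lbound E.
    exists (qform A v1 / qform 1%:M v1); apply: E_lb.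
    by apply/negP => /eqP/rowP/(_ 0)/eqP; rewrite !mxE oner_eq0.
  move=> /(ge_inf E_hlb); rewrite -subr_ge0 addrAC subrr add0r oppr_ge0.
  by rewrite leNgt invr_gt0 K0.
move=> v; rewrite qformD qformN qform_scalar subr_ge0.
by apply: le_trans (E_ge _ v E_inf) _; rewrite ler_wpM2r ?qform1_ge0.
Qed.

End QuadraticForms.

(** * The dimension of a span as a matrix rank *)

Section SpanDimension.
Import VectorInternalTheory.

(** Spans are encoded through the coordinates [v2r]. The matrix [L] passes from these to the
    coordinates [phi]; it is row free as [phi] is injective, so multiplying by it preserves rank. *)
Lemma dim_span_codom (K : fieldType) (vT : vectType K) n m
    (phi : {linear vT -> 'rV[K]_m}) (f : 'I_n -> vT) :
  injective phi -> \dim <<codom f>>%VS = \rank (\matrix_i phi (f i)).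
Proof.
move=> phi_inj; pose L := lin1_mx (phi \o r2v).
have freeL : row_free L.
  rewrite -kermx_eq0 -submx0; apply/rV_subP => v /sub_kermxP.
  rewrite mul_rV_lin1 /= -(linear0 phi) => /phi_inj v0.
  by rewrite -[v]r2vK v0 linear0 sub0mx.
rewrite /dimv [@span _ _]unlock mxrank_gen -(mxrankMfree _ freeL).
have rowL x : v2r x *m L = phi x.
  by rewrite mul_rV_lin1 /= v2rK.
apply/eqmx_rank/andP; split; apply/row_subP => i.
  have /codomP[j fj] : tnth (in_tuple (codom f)) i \in codom f.
    by apply: mem_tnth.
  rewrite row_mul rowK rowL fj.
  by rewrite -[phi _](rowK (fun i => phi (f i)) j) row_sub.
have /tnthP[j fj] : f i \in in_tuple (codom f) by apply: codom_f.
rewrite rowK fj -rowL.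
rewrite -[v2r _](rowK (fun j => v2r (tnth (in_tuple (codom f)) j))).
by rewrite -row_mul row_sub.
Qed.

End SpanDimension.

(** * Passing between codes, Gram matrices and graphs *)

Section CodesAndGraphs.
Variable R : realType.

Lemma code_rank_codom n m (S : {fset 'cV[R]_m}) (x : 'I_n -> 'cV[R]_m) :
  enum_fset S =i codom x -> code_rank S = \rank (\matrix_i (x i)^T).
Proof.
move=> /eq_span eqS; rewrite /code_rank eqS (dim_span_codom (phi := trmx)) //.
exact: trmx_inj.
Qed.

Lemma adjmx_sym (G : sgraph) : (adjmx R G)^T = adjmx R G.
Proof. by apply/matrixP => i j; rewrite !mxE sedge_sym. Qed.

(** The supremum is a true upper bound because [qform_bounded] bounds the spectrum from above. *)
Lemma eigenvalue_le_lambda1 (G : sgraph) a :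
  eigenvalue (adjmx R G) a -> a <= lambda1 R G.
Proof.
have [K psdK] := qform_bounded (adjmx R G).
by apply: ub_le_sup; exists K => b; apply: psd_eigenvalue_le.
Qed.

Lemma lambda1_le (G : sgraph) t :
  0 <= t -> psd (t%:M - adjmx R G) -> lambda1 R G <= t.
Proof.
move=> t0 psdt; rewrite /lambda1; set E := (X in sup X).
(* An empty spectrum has supremum 0 by default, whence the hypothesis [0 <= t]. *)
have [->|En0] := eqVneq E set0; first by rewrite sup0.
by apply: ge_sup => [|b]; [apply/set0P | apply: psd_eigenvalue_le].
Qed.

Lemma eig_codim_lambda1_lt (G : sgraph) (t : R) :
  lambda1 R G < t -> eig_codim G t = #|G|.
Proof.
move=> lt_t; apply/eqP; apply: contraTT lt_t; rewrite eig_codimE.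
by rewrite -eigenvalue_rank -leNgt => /eigenvalue_le_lambda1.
Qed.

Lemma gram_matrixE (G : sgraph) (beta : R) : beta != 0 ->
  1%:M + beta *: adjmx R G = - beta *: ((1 / - beta)%:M - adjmx R G).
Proof.
move=> b0; rewrite scalerBr scale_scalar_mx mulrC divfK ?oppr_eq0 //.
by rewrite scaleNr opprK.
Qed.

Lemma gram_rank (G : sgraph) (beta : R) : beta != 0 ->
  \rank (1%:M + beta *: adjmx R G)%R = eig_codim G (1 / - beta).
Proof.
by move=> b0; rewrite gram_matrixE // eig_codimE mxrank_scale_nz ?oppr_eq0.
Qed.

Lemma gram_psd (G : sgraph) (beta : R) : beta < 0 ->
  psd (1%:M + beta *: adjmx R G) <-> psd ((1 / - beta)%:M - adjmx R G).
Proof.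
move=> b0; rewrite gram_matrixE ?lt_eqF //.
by split=> psdM v; have := psdM v; rewrite qformZ pmulr_rge0 ?oppr_gt0.
Qed.

Lemma card_beta_graph m (beta : R) (S : {fset 'cV[R]_m}) :
  #|beta_graph beta S| = #|` S|.
Proof. by rewrite -cardfE. Qed.

(** The rows of [Y] are the transposed code vectors, in the order in which the vertices are
    enumerated. *)
Lemma beta_graph_gram m (beta : R) (S : {fset 'cV[R]_m}) :
  spherical_code beta S ->
  exists2 Y : 'M[R]_(#|beta_graph beta S|, m),
    Y *m Y^T = 1%:M + beta *: adjmx R (beta_graph beta S)
    & code_rank S = \rank Y.
Proof.
move=> [_ unitS dotS].
pose x (i : 'I_#|beta_graph beta S|) : 'cV[R]_m := val (enum_val i : S).
have xS i : x i \in S by exact: valP.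
exists (\matrix_i (x i)^T); last first.
  apply: code_rank_codom => y; apply/idP/codomP => [yS|[i ->]] //.
  exists (enum_rank ([` yS]%fset : beta_graph beta S)).
  by rewrite /x enum_rankK.
apply/matrixP => i j.
transitivity (dot (x i) (x j)).
  by rewrite /dot !mxE; apply: eq_bigr => k _; rewrite !mxE.
rewrite !mxE /= /beta_edge -/(x i) -/(x j).
have [->|ij] := eqVneq i j; first by rewrite eqxx /= mulr0 addr0 unitS.
rewrite (inj_eq enum_val_inj) ij /= add0r.
have xij : x i != x j by rewrite (inj_eq val_inj) (inj_eq enum_val_inj).
case: eqP => [->|neq]; first by rewrite mulr1.
by have [] := dotS _ _ (xS i) (xS j) xij => // ->; rewrite mulr0.
Qed.

Lemma gram_beta_graph m (beta : R) (G : sgraph) (Y : 'M[R]_(#|G|, m)) :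
  beta < 0 -> (0 < #|G|)%N -> Y *m Y^T = 1%:M + beta *: adjmx R G ->
  exists2 S : {fset 'cV[R]_m}, spherical_code beta S
    & code_rank S = \rank Y /\ sgraph_iso (beta_graph beta S) G.
Proof.
move=> b0 G0 defY.
pose x (u : G) : 'cV[R]_m := (row (enum_rank u) Y)^T.
have dotx u v : dot (x u) (x v) = (u == v)%:R + beta * (sedge u v)%:R.
  transitivity ((Y *m Y^T) (enum_rank u) (enum_rank v)).
    by rewrite /dot trmxK !mxE; apply: eq_bigr => k _; rewrite !mxE.
  by rewrite defY !mxE !enum_rankK (inj_eq enum_rank_inj).
have x_unit u : dot (x u) (x u) = 1.
  by rewrite dotx eqxx sedge_irrefl mulr0 addr0.
have x_neq u v : u != v -> dot (x u) (x v) = beta * (sedge u v)%:R.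
  by move=> /negPf uv; rewrite dotx uv add0r.
(* Equal vectors have inner product 1, while distinct vertices give at most 0 because [beta < 0].
   Hence no two vertices collapse in [S]. *)
have x_inj : injective x.
  move=> u v xuv; apply/eqP; apply: contraT => /x_neq.
  rewrite xuv x_unit => /eqP; rewrite gt_eqF //.
  by apply: le_lt_trans ltr01; rewrite mulr_le0_ge0 // ltW.
pose S := [fset x u | u in G]%fset.
have xS u : x u \in S by apply/imfsetP; exists u.
have Sx y : y \in S -> exists u, y = x u.
  by move=> /imfsetP[u _ ->]; exists u.
exists S.
  split.
  - have /card_gt0P[u _] := G0; apply/fset0Pn; exists (x u); exact: xS.
  - by move=> _ /Sx[u ->].
  - move=> _ _ /Sx[u ->] /Sx[v ->]; rewrite (inj_eq x_inj) => /x_neq ->.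
    by case: sedge; rewrite ?mulr1 ?mulr0; [right|left].
split.
  have -> : Y = \matrix_i (x (enum_val i))^T.
    by apply/row_matrixP => i; rewrite rowK trmxK enum_valK.
  apply: code_rank_codom => y; apply/idP/codomP => [/Sx[u ->]|[i ->]] //.
  by exists (enum_rank u); rewrite enum_rankK.
pose f (u : G) : beta_graph beta S := [` xS u]%fset.
have f_inj : injective f by move=> u v /(congr1 val) /= /x_inj.
have f_surj y : exists u, f u == y.
  by have [u yu] := Sx _ (valP y); exists u; apply/eqP/val_inj; rewrite /= yu.
(* The isomorphism must go from the code to [G], so the inverse of [f] is obtained by choice. *)
pose g y := xchoose (f_surj y).
have gK : cancel g f by move=> y; apply/eqP; exact: (xchooseP (f_surj y)).
have fK : cancel f g by move=> u; apply: f_inj; rewrite gK.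
exists g; first by exists f.
move=> y z; rewrite -{2}[y]gK -{2}[z]gK; move: (g y) (g z) => u v.
rewrite /= /beta_edge /= (inj_eq f_inj).
have [->|uv] := eqVneq u v; first by rewrite sedge_irrefl.
rewrite x_neq //; case: sedge; rewrite ?mulr1 ?mulr0 ?eqxx //.
by rewrite eq_sym lt_eqF.
Qed.

End CodesAndGraphs.

Theorem proposition4p1 (R : realType) (beta : R)
    (hbeta1 : -1 <= beta) (hbeta0 : beta < 0) :
  (forall (m n r : nat) (S : {fset 'cV[R]_m}),
     spherical_code beta S -> #|` S|%fset = n -> code_rank S = r ->
     (lambda1 R (beta_graph beta S) < 1 / (- beta) /\ n = r) \/
     (lambda1 R (beta_graph beta S) = 1 / (- beta) /\
      eig_codim (beta_graph beta S) (lambda1 R (beta_graph beta S)) = r))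
  /\
  (forall (G : sgraph) (n r : nat), (0 < n)%N -> #|G| = n ->
     (lambda1 R G < 1 / (- beta) /\ n = r) \/
     (lambda1 R G = 1 / (- beta) /\ eig_codim G (lambda1 R G) = r) ->
     exists (m : nat) (S : {fset 'cV[R]_m}),
       [/\ spherical_code beta S, code_rank S = r
         & sgraph_iso (beta_graph beta S) G]).
Proof.
have t0 : 0 <= 1 / - beta by rewrite divr_ge0 // oppr_ge0 ltW.
have b0 : beta != 0 by rewrite lt_eqF.
split=> [m n r S codeS cardS rankS|G n r n0 cardG lamG].
  have [Y gramY rkY] := beta_graph_gram codeS.
  (* This holds in both alternatives; they differ only in whether [lambda1] reaches [1 / - beta]. *)
  have rankr : eig_codim (beta_graph beta S) (1 / - beta) = r.
    by rewrite -gram_rank // -gramY mxrank_gram -rkY.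
  have : lambda1 R (beta_graph beta S) <= 1 / - beta.
    apply: (lambda1_le t0); apply: (gram_psd _ hbeta0).1.
    by rewrite -gramY; apply: psd_gram.
  rewrite le_eqVlt => /predU1P[->|lt_t]; [by right|left; split=> //].
  by rewrite -rankr eig_codim_lambda1_lt // card_beta_graph.
have le_t : lambda1 R G <= 1 / - beta.
  by case: lamG => -[]; [move/ltW|move=> ->].
have psdM : psd (1%:M + beta *: adjmx R G).
  apply: (gram_psd _ hbeta0).2.
  apply: psd_eigenvalue_bound (adjmx_sym _ _) _ => a.
  by move=> /eigenvalue_le_lambda1 le_a; apply: le_trans le_a le_t.
have [|Y gramY] := psd_gram_exists _ psdM.
  by rewrite linearD linearZ /= tr_scalar_mx adjmx_sym.
have [||S codeS [rkS isoS]] := gram_beta_graph _ _ gramY => //.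
  by rewrite cardG.
(* The Gram factor is square, so the ambient dimension is the number of vertices. *)
exists #|G|, S; split => //.
rewrite rkS -mxrank_gram gramY gram_rank //.
(* Below the threshold the codimension is full, equal to [n]; at the threshold it is [r] by
   assumption. *)
by case: lamG => -[lam <-]; [rewrite eig_codim_lambda1_lt | rewrite lam].
Qed.
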